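(* Let $w=c_0x_{\iota(1)}^{\varepsilon(1)}c_1\cdots c_{l-1}x_{\iota(l)}^{\varepsilon(l)}c_l\in\mathrm{GL}_n(\mathbb{C})\ast\mathbf{F}_r$ be reduced (with respect to $\mathrm{SL}_n(\mathbb{C})$) of length $l\geq 2$. Then $$\dim w(\mathrm{SL}_n(\mathbb{C})^r)\geq\left\lfloor\frac{|w|_{\rm crit}-1}{l}\right\rfloor\cdot n.$$
   Context: $\mathbf{F}_r=\langle x_1,\ldots,x_r\rangle$ is the free group of rank $r$. For a group $G$, $w\in G\ast\mathbf{F}_r$ and $h_1,\dots,h_r\in G$, $w(h_1,\dots,h_r)$ is the image of $w$ under the homomorphism $G\ast\mathbf{F}_r\to G$ that is the identity on $G$ and maps $x_i\mapsto h_i$. The word image is $w(\mathrm{SL}_n(\mathbb{C})^r)=\{w(h_1,\dots,h_r):h_i\in\mathrm{SL}_n(\mathbb{C})\}$, a constructible subset of $\mathrm{GL}_n(\mathbb{C})$; its dimension is the dimension of its Zariski closure. Put $G=\mathrm{GL}_n(\mathbb{C})$; here $c_j\in G$, $\iota(j)\in\{1,\dots,r\}$, $\varepsilon(j)\in\{\pm1\}$, and the length of $w$ is $l$. Define subsets of $\{1,\dots,l-1\}$: $J_0(w)=\{j:\iota(j)\neq\iota(j+1)\}$, $J_+(w)=\{j:\iota(j)=\iota(j+1),\ \varepsilon(j)=\varepsilon(j+1)\}$, $J_-(w)=\{j:\iota(j)=\iota(j+1),\ \varepsilon(j)=-\varepsilon(j+1)\}$. The word is reduced with respect to $H\leq G$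 (here $H=\mathrm{SL}_n(\mathbb{C})$, the group whose elements are plugged in) if $c_j\notin\mathbf{C}_G(H)\setminus\{1\}$ for $j\in J_0(w)\cup J_+(w)$ and $c_j\notin\mathbf{C}_G(H)$ for $j\in J_-(w)$, where $\mathbf{C}_G(H)$ is the centralizer of $H$ in $G$. The projective rank seminorm on $\mathrm{GL}_n(\mathbb{C})$ is $|g|=\min_{\lambda\in\mathbb{C}^\times}\mathrm{rk}(g-\lambda 1)$, with pseudometric $\mathrm{dist}(g,h)=|g^{-1}h|$. The critical length is $|w|_{\rm crit}=\min\left(\{\mathrm{diam}(\mathrm{GL}_n(\mathbb{C}))\}\cup\{|c_j|: j\in J_-(w)\}\right)$, the diameter being taken in this pseudometric. *)

(* Defs.v *)
(* mpoly must be imported before boolp, otherwise their notations clash. *)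
From HB Require Import structures.
From mathcomp Require Import all_boot all_order all_algebra.
From mathcomp Require Import mpoly.
From mathcomp Require Import boolp classical_sets reals constructive_ereal.
From mathcomp Require ereal.

Set Implicit Arguments.
Unset Strict Implicit.
Unset Printing Implicit Defensive.

Import Order.TTheory GRing.Theory Num.Theory.

Local Open Scope classical_set_scope.
Local Open Scope ring_scope.

Section LinearGroups.
Variables (F : fieldType) (n : nat).

Definition GL : set 'M[F]_n := [set g | g \in unitmx].

Definition SL : set 'M[F]_n := [set g | \det g = 1].

Definition centralizer (G H : set 'M[F]_n) : set 'M[F]_n :=
  [set g | G g /\ forall h, H h -> g *m h = h *m g].

End LinearGroups.

Section ProjectiveRank.
Variables (F : fieldType) (n : nat).
Implicit Types g h : 'M[F]_n.

Definition prank_val g : pred nat :=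
  fun m => `[< exists2 lambda : F, lambda != 0 & \rank (g - lambda%:M) = m >].

Lemma prank_val_ex g : exists m, prank_val g m.
Proof. by exists (\rank (g - 1%:M)); apply/asboolP; exists 1; rewrite ?oner_eq0. Qed.

Definition prank g : nat := ex_minn (prank_val_ex g).

Definition prank_dist g h : nat := prank (invmx g *m h).

Definition dist_val : pred nat :=
  fun m => `[< exists g h, [/\ GL g, GL h & prank_dist g h = m] >].

Lemma dist_val_ex : exists m, dist_val m.
Proof.
by exists (prank_dist 1%:M 1%:M); apply/asboolP; exists 1%:M, 1%:M;
  split=> //; apply: unitmx1.
Qed.

Lemma dist_val_ub m : dist_val m -> (m <= n)%N.
Proof.
move=> /asboolP[g [h [_ _ <-]]]; rewrite /prank_dist /prank.
by case: ex_minnP => k /asboolP[lambda _ <-] _; apply: rank_leq_row.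
Qed.

Definition diam_GL : nat := ex_maxn dist_val_ex dist_val_ub.

End ProjectiveRank.

(* An expression c_0 x_{iota(1)}^{eps(1)} c_1 ... x_{iota(l)}^{eps(l)} c_l
   denoting an element of GL_n(F) * F_r. Letters are numbered from 1 to l; only
   coef 0, ..., coef l, and var j, neg j for 1 <= j <= l, are meaningful. As in
   (-1) ^+ b, neg j = true stands for the exponent -1. *)
Record word (F : fieldType) (n r : nat) := Word {
  wlen : nat;
  coef : nat -> 'M[F]_n;
  var : nat -> 'I_r;
  neg : nat -> bool;
  coef_GL : forall j, (j <= wlen)%N -> GL (coef j)
}.

Section Words.
Variables (F : fieldType) (n r : nat) (w : word F n r).

Definition letter_eval (h : 'I_r -> 'M[F]_n) (j : nat) : 'M[F]_n :=
  if neg w j then invmx (h (var w j)) else h (var w j).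

Definition word_eval (h : 'I_r -> 'M[F]_n) : 'M[F]_n :=
  coef w 0 *m \prod_(1 <= j < (wlen w).+1) (letter_eval h j *m coef w j).

Definition word_image (H : set 'M[F]_n) : set 'M[F]_n :=
  [set word_eval h | h in [set h | forall i, H (h i)]].

Definition J0 : pred nat := [pred j | (1 <= j < wlen w)%N
  && (var w j != var w j.+1)].

Definition Jplus : pred nat := [pred j | (1 <= j < wlen w)%N
  && (var w j == var w j.+1) && (neg w j == neg w j.+1)].

Definition Jminus : pred nat := [pred j | (1 <= j < wlen w)%N
  && (var w j == var w j.+1) && (neg w j != neg w j.+1)].

Definition reduced (H : set 'M[F]_n) : Prop :=
  (forall j, j \in [predU J0 & Jplus] ->
     ~ (centralizer (@GL F n) H `\ 1%:M) (coef w j)) /\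
  (forall j, j \in Jminus -> ~ centralizer (@GL F n) H (coef w j)).

Definition crit_length : nat :=
  \big[minn/diam_GL F n]_(1 <= j < wlen w | j \in Jminus) prank (coef w j).

End Words.

Section ZariskiDimension.
Variables (F : fieldType) (n : nat).
Implicit Types X Z : set 'M[F]_n.

(* Closed subsets of GL_n, i.e. traces on GL_n of the Zariski closed subsets of
   the affine space of matrices: since det is invertible on GL_n, functions in
   F[x_ij, det^-1] cut out no further sets. *)
Definition zclosed Z : Prop :=
  exists S : set {mpoly F[n * n]},
    Z = [set g | GL g /\ forall p, S p -> p.@[fun k => mxvec g 0 k] = 0].

Definition zclosure X : set 'M[F]_n :=
  [set g | forall Z, zclosed Z -> X `<=` Z -> Z g].

Definition zirreducible Z : Prop :=
  Z !=set0 /\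
  forall Z1 Z2, zclosed Z1 -> zclosed Z2 -> Z `<=` Z1 `|` Z2 ->
    Z `<=` Z1 \/ Z `<=` Z2.

Definition zchain X (k : nat) (Z : nat -> set 'M[F]_n) : Prop :=
  (forall i, (i <= k)%N -> [/\ zclosed (Z i), zirreducible (Z i) & Z i `<=` X])
  /\ (forall i, (i < k)%N -> Z i `<` Z i.+1).

(* Krull dimension of the Zariski closure of X in GL_n; -oo if X is empty. *)
Definition zdim (R : realType) X : \bar R :=
  ereal.ereal_sup [set (k%:R)%:E | k in
    [set k : nat | exists Z : nat -> set 'M[F]_n, zchain (zclosure X) k Z]].

End ZariskiDimension.

(* Main.v *)
(* Write k for the floor of (|w|_crit - 1) / l and let k independent row vectors U
   travel through w from left to right. The letters are treated one after the
   other, and at each letter the value of its variable on the k incoming vectors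
   is chosen so that the vectors entering the next letter are independent modulo
   those on which the next variable is already constrained. Only a letter
   followed by its inverse needs care: there both E and E c_j have to be
   independent modulo a subspace, which is possible as long as fewer than |c_j|
   dimensions are occupied; in total at most k l < |w|_crit vectors occur.

   The k vectors leaving the last letter are then unconstrained up to an open
   condition, and the variables producing them can be taken to be rational
   functions of them. Hence g |-> U g restricted to the word image has a rational
   section over a nonempty open subset of the affine space of dimension k n, and
   the closures of the images of a flag of linear subspaces form a chain of
   irreducible closed sets of length k n. *)
Require Import Defs.
From mathcomp Require Import all_boot all_order all_algebra.
From mathcomp Require Import boolp classical_sets reals constructive_ereal.
From mathcomp Require Import complex.
From mathcomp Require mpoly ereal.
From mathcomp Require Import (canonicals) mpoly.
From mathcomp Require Import zify ring.

Set Implicit Arguments.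
Unset Strict Implicit.
Unset Printing Implicit Defensive.

Import Order.TTheory GRing.Theory Num.Theory.

Local Open Scope ring_scope.

(** * Linear algebra: vectors in general position and extension to determinant one *)

Section LinearAlgebra.
Variable F : fieldType.

(** Conjugating [U] by the unipotent [L] moves the product of [a] and [b] from one diagonal block to
    the other. *)
Lemma det_add1_mul n (a : 'cV[F]_n) (b : 'rV[F]_n) :
  \det (1%:M + a *m b) = 1 + (b *m a) 0 0.
Proof.
pose L := block_mx 1%:M 0 b (1%:M : 'M_1).
pose L' := block_mx 1%:M 0 (- b) (1%:M : 'M_1).
pose U := block_mx (1%:M + a *m b) a 0 (1%:M : 'M_1).
have : L *m U *m L' = block_mx 1%:M a 0 (1%:M + b *m a).
  rewrite !mulmx_block !(mul1mx, mulmx1, mul0mx, mulmx0, addr0, add0r).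
  rewrite mulmxDr mulmx1 !mulmxN mulmxDl mul1mx mulmxA addrK.
  by rewrite [b + _]addrC subrr [b *m a + _]addrC.
move/(congr1 determinant); rewrite !det_mulmx !det_lblock !det_ublock !det1.
by rewrite !(mulr1, mul1r) det_mx11 !mxE eqxx => ->; rewrite mulr1n.
Qed.

Lemma rank_adds_row m n (W : 'M[F]_(m, n)) (e : 'rV[F]_n) :
  ~~ (e <= W)%MS -> \rank (W + e) = (\rank W).+1.
Proof.
move=> eW; apply/eqP; rewrite eqn_leq; apply/andP; split.
  apply: leq_trans (mxrank_adds_leqif W e) _.
  by rewrite -[X in (_ <= X)%N]addn1 leq_add2l rank_leq_row.
by rewrite (ltn_leqif (mxrank_leqif_sup (addsmxSl W e))) addsmx_sub submx_refl.
Qed.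

Lemma exists_notin_submx m n (W : 'M[F]_(m, n)) :
  (\rank W < n)%N -> exists e : 'rV[F]_n, ~~ (e <= W)%MS.
Proof.
move=> rW; have /row_subPn[i Hi] : ~~ (1%:M <= W)%MS.
  by apply: contraL rW => /mxrankS; rewrite mxrank1 -leqNgt.
by exists (row i 1%:M).
Qed.

(** Over any field, a space is not the union of two proper subspaces: if [e] and [f] each avoid only
    one of them, [e + f] avoids both. *)
Lemma exists_notin_submx2 m1 m2 n (V : 'M[F]_(m1, n)) (W : 'M[F]_(m2, n)) :
  (\rank V < n)%N -> (\rank W < n)%N ->
  exists2 e : 'rV[F]_n, ~~ (e <= V)%MS & ~~ (e <= W)%MS.
Proof.
move=> /exists_notin_submx[e eV] /exists_notin_submx[f fW].
have [eW|eW] := boolP (e <= W)%MS; last by exists e.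
have [fV|fV] := boolP (f <= V)%MS; last by exists f.
exists (e + f).
  by apply: contra eV => H; rewrite -(addrK f e) addmx_sub // eqmx_opp.
by apply: contra fW => H; rewrite -(addKr e f) addmx_sub // eqmx_opp.
Qed.

Lemma adds_col_mx m k n (S : 'M[F]_(m, n)) (e : 'rV[F]_n) (E : 'M[F]_(k, n)) :
  (S + (col_mx e E : 'M_(k.+1, n)) :=: S + E + e)%MS.
Proof.
apply: eqmx_trans (adds_eqmx (eqmx_refl S) (eqmx_sym (addsmxE e E))) _.
by rewrite -addsmxA [(e + E)%MS]addsmxC.
Qed.

Lemma exists_free_mod2 m1 m2 k n (V : 'M[F]_(m1, n)) (W : 'M[F]_(m2, n)) :
  (\rank V + k <= n)%N -> (\rank W + k <= n)%N ->
  exists E : 'M[F]_(k, n),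
    \rank (V + E) = (\rank V + k)%N /\ \rank (W + E) = (\rank W + k)%N.
Proof.
elim: k => [|k IHk] Vk Wk.
  by exists 0; rewrite !addn0 !addsmx0.
have [E [rV rW]] := IHk ltac:(lia) ltac:(lia).
have [||e eV eW] := @exists_notin_submx2 _ _ _ (V + E)%MS (W + E)%MS.
- by rewrite rV -addnS.
- by rewrite rW -addnS.
by exists (col_mx e E); split; rewrite adds_col_mx rank_adds_row // ?rV ?rW addnS.
Qed.

(** Testing basis vectors makes [M] diagonal; testing their sums with the first one equates the
    diagonal entries. *)
Lemma eigen_all_scalar d (M : 'M[F]_d) :
  (forall f : 'rV_d, f != 0 -> exists mu, f *m M = mu *: f) ->
  exists mu, M = mu%:M.
Proof.
case: d M => [|d] M HM; first by exists 0; rewrite flatmx0 [RHS]flatmx0.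
have delta0 (i : 'I_d.+1) : delta_mx 0 i != 0 :> 'rV[F]_d.+1.
  by apply/eqP => /rowP/(_ i); rewrite !mxE !eqxx => /eqP; rewrite oner_eq0.
have Mij i j : i != j -> M i j = 0.
  move=> ij; have [mu /rowP/(_ j)] := HM _ (delta0 i).
  by rewrite -rowE !mxE eq_sym (negPf ij) andbF mulr0.
exists (M 0 0); apply/matrixP=> i j; rewrite mxE.
have [<-|/Mij ->] := eqVneq i j; last by [].
have [->//|i0] := eqVneq i 0; rewrite mulr1n.
have ne0 : delta_mx 0 i + delta_mx 0 0 != 0 :> 'rV[F]_d.+1.
  apply/eqP => /rowP/(_ i); rewrite !mxE !eqxx (negPf i0) addr0 => /eqP.
  by rewrite oner_eq0.
have [mu] := HM _ ne0; rewrite mulmxDl -!rowE => /rowP H.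
have := H i; have := H 0.
rewrite !mxE !eqxx [0 == i]eq_sym (negPf i0) /= (Mij i 0) // (Mij 0 i) 1?eq_sym //.
by rewrite !(add0r, addr0) => -> ->.
Qed.

(* Were [e] and [e *m c] always dependent modulo [W], [c] would induce a scalar
   on the quotient by [W], so some [c - mu%:M] would have its image in [W]. *)
Lemma exists_free_pair_mod m n (W : 'M[F]_(m, n)) (c : 'M[F]_n) :
  c \in unitmx ->
  (forall mu : F, mu != 0 -> (\rank W < \rank (c - mu%:M)%R)%N) ->
  ((\rank W).+2 <= n)%N ->
  exists e : 'rV[F]_n, \rank (W + e + e *m c) = (\rank W).+2.
Proof.
move=> c_unit rc rW.
have rW' : (2 <= \rank (cokermx W))%N.
  by rewrite mxrank_coker leq_subRL ?addn2 // ltnW // ltnW.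
apply: contrapT => /forallNP He.
(* [col_base (cokermx W)], renamed [A] below, represents the quotient map by [W]: its kernel is [W]
   and it is onto a space of dimension [d]. *)
have WA : W *m col_base (cokermx W) = 0.
  apply: (row_free_inj (row_base_free (cokermx W))).
  by rewrite -mulmxA mulmx_base mulmx_coker mul0mx.
have AW (e : 'rV_n) : e *m col_base (cokermx W) = 0 -> (e <= W)%MS.
  by move=> eA; rewrite submxE -(mulmx_base (cokermx W)) mulmxA eA mul0mx.
have Afull := col_base_full (cokermx W).
have dW := mxrank_coker W.
move: rW' dW (col_base _) WA AW Afull => /=.
move: (\rank (cokermx W)) => d d2 dW A WA AW Afull.
have [P PA] : exists P, P *m A = 1%:M by exists (pinvmx A); apply: mulVpmx.
have dep (e : 'rV_n) : e *m A != 0 -> exists mu, e *m (c *m A) = mu *: (e *m A).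
  move=> eA; have eW : ~~ (e <= W)%MS.
    by apply: contra eA => /submxP[D ->]; rewrite -mulmxA WA mulmx0.
  have : (e *m c <= W + e)%MS.
    apply/negPn/negP => ecW; apply: (He e).
    by rewrite rank_adds_row // rank_adds_row.
  case/sub_addsmxP => -[u v] /= H; exists (v 0 0).
  rewrite mulmxA H mulmxDl -!mulmxA WA mulmx0 add0r.
  by rewrite [v in LHS]mx11_scalar mul_scalar_mx.
have [mu PB] : exists mu, P *m (c *m A) = mu%:M.
  apply: eigen_all_scalar => f f0.
  have fPA : f *m P *m A = f by rewrite -mulmxA PA mulmx1.
  by have [|mu] := dep (f *m P); rewrite fPA // -mulmxA => ->; exists mu.
(* Adding [e] from [W] to lifts of basis vectors shows that the image of [e *m c] in the quotient is
   proportional to every basis vector; as [d] is at least 2, it vanishes. *)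
have kerA (e : 'rV_n) : e *m A = 0 -> e *m (c *m A) = 0.
  move=> eA; have H i : exists nu, e *m (c *m A) = nu *: (delta_mx 0 i : 'rV_d).
    have fA : (delta_mx 0 i *m P + e) *m A = delta_mx 0 i.
      by rewrite mulmxDl eA addr0 -mulmxA PA mulmx1.
    have [|nu] := dep (delta_mx 0 i *m P + e).
      rewrite fA; apply/eqP => /rowP/(_ i); rewrite !mxE !eqxx => /eqP.
      by rewrite oner_eq0.
    rewrite fA mulmxDl -mulmxA PB mul_mx_scalar => E.
    by exists (nu - mu); rewrite scalerBl -E addrC addKr.
  pose i0 : 'I_d := Ordinal (ltnW d2); pose i1 : 'I_d := Ordinal d2.
  have [nu0 E0] := H i0; have [nu1 E1] := H i1.
  have := congr1 (fun M : 'rV_d => M 0 i0) E1.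
  rewrite E0 !mxE !eqxx /= mulr1 mulr0 => ->; exact: scale0r.
have cA : (c - mu%:M) *m A = 0.
  apply/row_matrixP => i; rewrite row_mul row0 rowE.
  set e := delta_mx 0 i; rewrite mulmxBr mulmxBl mul_mx_scalar -scalemxAl.
  have : (e - e *m A *m P) *m (c *m A) = 0.
    by apply: kerA; rewrite mulmxBl -!mulmxA PA mulmx1 subrr.
  rewrite mulmxBl -!mulmxA PB !mulmxA mul_mx_scalar; exact: id.
have A0 : A != 0.
  apply/eqP => A0; move: Afull; rewrite A0 /row_full mxrank0.
  by case: (d) d2.
(* The rank hypothesis concerns nonzero [mu] only; [mu = 0] would force [c *m A = 0], against the
   invertibility of [c]. *)
have mu0 : mu != 0.
  apply: contraNneq A0 => mu0; rewrite mu0 raddf0 subr0 in cA.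
  by rewrite -(mulKmx c_unit A) cA mulmx0.
have := mulmx0_rank_max cA; move: (rc _ mu0).
have -> : \rank A = d by apply/eqP.
have : (d + \rank W)%N = n.
  by rewrite dW subnK // rank_leq_col.
move=> E lt_rk; rewrite -[X in (_ <= X)%N -> _]E addnC leq_add2l => ge_rk.
by rewrite ltnNge ge_rk in lt_rk.
Qed.

Lemma exists_free_pairs_mod m k n (W : 'M[F]_(m, n)) (c : 'M[F]_n) :
  c \in unitmx ->
  (forall mu : F, mu != 0 -> (\rank W + k.*2 <= \rank (c - mu%:M)%R)%N) ->
  exists E : 'M[F]_(k, n), \rank (W + E + E *m c) = (\rank W + k.*2)%N.
Proof.
move=> c_unit; elim: k => [|k IHk] rk_c.
  by exists 0; rewrite mul0mx !addsmx0 addn0.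
have [mu mu0|E rE] := IHk.
  by apply: leq_trans (rk_c mu mu0); rewrite leq_add2l leq_double.
have [||e re] := @exists_free_pair_mod _ _ (W + E + E *m c)%MS c c_unit.
- by move=> mu mu0; rewrite rE; apply: leq_trans (rk_c mu mu0); rewrite doubleS !addnS.
(* Since ranks are at most [n], the hypothesis at [mu = 1] also gives the room needed in the whole
   space. *)
- rewrite rE -2!addnS -doubleS; apply: leq_trans (rk_c 1 (oner_neq0 _)) _.
  exact: rank_leq_row.
exists (col_mx e E); rewrite doubleS 2!addnS -rE -re.
rewrite (mul_col_mx e E c) (adds_eqmx (adds_col_mx _ _ _) (eqmx_refl _)).
by rewrite adds_col_mx -[(_ + e + _)%MS]addsmxA [(e + _)%MS]addsmxC addsmxA.
Qed.

Lemma exists_annihilator m n (U : 'M[F]_(m, n)) :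
  (\rank U < n)%N ->
  exists (a : 'cV[F]_n) (b : 'rV[F]_n), U *m a = 0 /\ b *m a = 1%:M.
Proof.
move=> rU; have /rowV0Pn[v /sub_kermxP vU v0] : kermx U^T != 0.
  by rewrite -mxrank_eq0 mxrank_ker mxrank_tr subn_eq0 -ltnNge.
exists v^T, (pinvmx v^T); split.
  by apply: trmx_inj; rewrite trmx_mul trmxK vU trmx0.
by apply: mulVpmx; rewrite /row_full mxrank_tr rank_rV v0.
Qed.

(** When [b *m a = 1], this scales [b] by [d] and fixes all rows killed by [a], so it adjusts a
    determinant without disturbing prescribed images. *)
Definition stretch n (a : 'cV[F]_n) (b : 'rV[F]_n) (d : F) : 'M[F]_n :=
  1%:M + (d - 1) *: (a *m b).

Lemma det_stretch n (a : 'cV[F]_n) (b : 'rV[F]_n) d :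
  b *m a = 1%:M -> \det (stretch a b d) = d.
Proof.
move=> ba; rewrite /stretch scalemxAl det_add1_mul.
by rewrite -scalemxAr ba !mxE eqxx mulr1 addrC subrK.
Qed.

Lemma mul_stretch m n (U : 'M[F]_(m, n)) (a : 'cV[F]_n) (b : 'rV[F]_n) d :
  U *m a = 0 -> U *m stretch a b d = U.
Proof.
move=> Ua; rewrite mulmxDr mulmx1 -scalemxAr mulmxA Ua mul0mx.
by rewrite scaler0 addr0.
Qed.

(** The rows of [T] stay independent in the quotient by [S]; [Q] is the quotient map followed by a
    one-sided inverse of the image of [T]. *)
Lemma exists_dual m k n (S : 'M[F]_(m, n)) (T : 'M[F]_(k, n)) :
  \rank (S + T) = (\rank S + k)%N ->
  exists Q : 'M[F]_(n, k), S *m Q = 0 /\ T *m Q = 1%:M.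
Proof.
move=> rST.
have [rT rcap] : \rank T = k /\ \rank (S :&: T) = 0%N.
  have := mxrank_sum_cap S T; rewrite rST -addnA => /addnI.
  by have := rank_leq_row T; lia.
have fT : row_free (T *m cokermx S).
  rewrite /row_free; have := mxrank_mul_ker T (cokermx S); rewrite rT.
  suff -> : \rank (T :&: kermx (cokermx S)) = 0%N by rewrite addn0 => ->.
  apply/eqP; rewrite -leqn0 -rcap capmxC; apply/mxrankS/capmxS => //.
  by rewrite submxE mulmx_ker.
exists (cokermx S *m pinvmx (T *m cokermx S)); split.
  by rewrite mulmxA mulmx_coker mul0mx.
by rewrite mulmxA mulmxVp.
Qed.

(** The map [f] is right on [S] and [T] but may be singular. Being injective on their span, it
    agrees there with an invertible [g]; the span is proper, so a [stretch] fixing it normalises the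
    determinant. *)
Lemma exists_SL_extending m k n (S : 'M[F]_(m, n)) (T E : 'M[F]_(k, n)) :
  \rank (S + T) = (\rank S + k)%N -> \rank (S + E) = (\rank S + k)%N ->
  (\rank S + k < n)%N ->
  exists g : 'M[F]_n, [/\ \det g = 1, S *m g = S & T *m g = E].
Proof.
move=> rST rSE rn; have [Q [SQ TQ]] := exists_dual rST.
pose f : 'M[F]_n := 1%:M + Q *m (E - T).
have Sf : S *m f = S by rewrite mulmxDr mulmx1 mulmxA SQ mul0mx addr0.
have Tf : T *m f = E by rewrite mulmxDr mulmx1 mulmxA TQ mul1mx addrC subrK.
have [|g g_unit] := @complete_unitmx _ _ _ (col_mx S T) f.
  by rewrite mul_col_mx Sf Tf -!addsmxE rST.
rewrite !mul_col_mx Sf Tf => /eq_col_mx[Sg Tg].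
have [|a [b []]] := @exists_annihilator _ _ (col_mx S T).
  by rewrite -addsmxE rST.
rewrite mul_col_mx -col_mx0 => /eq_col_mx[Sa Ta] ba.
exists (stretch a b (\det g)^-1 *m g); split.
- by rewrite det_mulmx det_stretch // mulVf // -unitfE -unitmxE.
- by rewrite mulmxA mul_stretch.
by rewrite mulmxA mul_stretch.
Qed.

End LinearAlgebra.

(** * Rational functions of one variable with a fixed denominator *)

Section RegularFunctions.
Variable F : numFieldType.

Lemma exists_nonroot (p : {poly F}) : p != 0 -> exists t, p.[t] != 0.
Proof.
move=> p0; apply: contrapT => /forallNP Hp.
have := @max_poly_roots _ p [seq i%:R | i <- iota 0 (size p)] p0.
rewrite size_map size_iota ltnn map_inj_uniq ?iota_uniq; last first.
  by move=> i j /eqP; rewrite eqr_nat => /eqP.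
suff -> : all (root p) [seq i%:R | i <- iota 0 (size p)] by move=> /(_ isT isT).
apply/allP => t _; rewrite rootE; apply/negPn/negP; exact: Hp.
Qed.

(** Membership in the localization of the polynomial ring at [q], with denominators cleared; values
    of [f] at roots of [q] stay arbitrary. *)
Definition regular (q : {poly F}) (f : F -> F) : Prop :=
  exists (m : nat) (p : {poly F}),
    forall t, q.[t] != 0 -> q.[t] ^+ m * f t = p.[t].

Variable q : {poly F}.

Lemma regular_cst c : regular q (fun=> c).
Proof. by exists 0, c%:P => t _; rewrite hornerC mul1r. Qed.

Lemma regular_id : regular q id.
Proof. by exists 0, 'X => t _; rewrite hornerX mul1r. Qed.

Lemma regularD f g :
  regular q f -> regular q g -> regular q (fun t => f t + g t).
Proof.
move=> [m [p fp]] [m' [p' gp]]; exists (m + m')%N, (q ^+ m' * p + q ^+ m * p').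
move=> t qt; rewrite !hornerE -fp // -gp // exprD.
by ring.
Qed.

Lemma regularM f g :
  regular q f -> regular q g -> regular q (fun t => f t * g t).
Proof.
move=> [m [p fp]] [m' [p' gp]]; exists (m + m')%N, (p * p') => t qt.
by rewrite hornerM -fp // -gp // exprD; ring.
Qed.

Lemma regularV : regular q (fun t => q.[t]^-1).
Proof. by exists 1%N, 1 => t qt; rewrite hornerE expr1 divff. Qed.

Lemma regular_sum I (r : seq I) (f : I -> F -> F) :
  (forall i, regular q (f i)) -> regular q (fun t => \sum_(i <- r) f i t).
Proof.
move=> fr; elim: r => [|i r IHr].
  by under eq_fun do rewrite big_nil; exact: regular_cst.
by under eq_fun do rewrite big_cons; exact: regularD.
Qed.

Lemma regular_prod I (r : seq I) (f : I -> F -> F) :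
  (forall i, regular q (f i)) -> regular q (fun t => \prod_(i <- r) f i t).
Proof.
move=> fr; elim: r => [|i r IHr].
  by under eq_fun do rewrite big_nil; exact: regular_cst.
by under eq_fun do rewrite big_cons; exact: regularM.
Qed.

Lemma regularX f m : regular q f -> regular q (fun t => f t ^+ m).
Proof.
move=> fr; elim: m => [|m IHm].
  by under eq_fun do rewrite expr0; exact: regular_cst.
by under eq_fun do rewrite exprS; exact: regularM.
Qed.

Definition regular_mx m n (A : F -> 'M[F]_(m, n)) : Prop :=
  forall i j, regular q (fun t => A t i j).

Lemma regular_mx_cst m n (A : 'M[F]_(m, n)) : regular_mx (fun=> A).
Proof. by move=> i j; exact: regular_cst. Qed.

Lemma regular_mxD m n (A B : F -> 'M[F]_(m, n)) :
  regular_mx A -> regular_mx B -> regular_mx (fun t => A t + B t).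
Proof.
move=> Ar Br i j; under eq_fun do rewrite mxE.
exact: regularD.
Qed.

Lemma regular_mxZ m n f (A : F -> 'M[F]_(m, n)) :
  regular q f -> regular_mx A -> regular_mx (fun t => f t *: A t).
Proof.
move=> fr Ar i j; under eq_fun do rewrite mxE.
exact: regularM.
Qed.

Lemma regular_mxM m n p (A : F -> 'M[F]_(m, n)) (B : F -> 'M[F]_(n, p)) :
  regular_mx A -> regular_mx B -> regular_mx (fun t => A t *m B t).
Proof.
move=> Ar Br i j; under eq_fun do rewrite mxE.
by apply: regular_sum => k; exact: regularM.
Qed.

Lemma regular_det n (A : F -> 'M[F]_n) :
  regular_mx A -> regular q (fun t => \det (A t)).
Proof.
move=> Ar; apply: regular_sum => s; apply: regularM; first exact: regular_cst.
exact: regular_prod.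
Qed.

Lemma regular_adj n (A : F -> 'M[F]_n) :
  regular_mx A -> regular_mx (fun t => \adj (A t)).
Proof.
move=> Ar i j; under eq_fun do rewrite mxE /cofactor.
apply: regularM; first exact: regular_cst.
apply: regular_det => i' j'; under eq_fun do rewrite !mxE; exact: Ar.
Qed.

(** With determinant 1 the inverse is the adjugate, so no new denominator arises. *)
Lemma regular_mx_invmx n (A : F -> 'M[F]_n) :
  (forall t, q.[t] != 0 -> \det (A t) = 1) ->
  regular_mx A -> regular_mx (fun t => invmx (A t)).
Proof.
move=> detA Ar i j; have [m [p Hp]] := regular_adj Ar i j.
exists m, p => t qt; rewrite -Hp //.
by rewrite /invmx unitmxE detA // unitr1 invr1 scale1r.
Qed.

Lemma regular_meval n (A : F -> 'M[F]_n) (p : mpoly.mpoly (n * n) F) :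
  regular_mx A ->
  regular q (fun t => mpoly.meval (fun k => mxvec (A t) 0 k) p).
Proof.
move=> Ar; under eq_fun do rewrite mpoly.mevalE.
apply: regular_sum => m; apply: regularM; first exact: regular_cst.
apply: regular_prod => k; apply: regularX.
case/mxvec_indexP: k => i j; under eq_fun do rewrite mxvecE; exact: Ar.
Qed.

End RegularFunctions.

(** * Zariski closures and irreducibility *)

Section ZariskiHull.
Local Open Scope classical_set_scope.
Variables (F : numFieldType) (n : nat).
Implicit Types (A X Z : set 'M[F]_n) (p : mpoly.mpoly (n * n) F).

Definition mxeval p (g : 'M[F]_n) : F := mpoly.meval (fun k => mxvec g 0 k) p.

(** For [A] inside [GL] this is the Zariski closure, given by explicit equations rather than as an
    intersection of closed sets. *)
Definition zhull A : set 'M[F]_n :=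
  [set g | @GL F n g /\ forall p, (forall x, A x -> mxeval p x = 0) -> mxeval p g = 0].

Lemma zclosed_zhull A : zclosed (zhull A).
Proof. by exists [set p | forall x, A x -> mxeval p x = 0]. Qed.

Lemma subset_zhull A : A `<=` @GL F n -> A `<=` zhull A.
Proof. by move=> AGL g Ag; split=> [|p]; [exact: AGL | exact]. Qed.

Lemma zhull_subset A Z : zclosed Z -> A `<=` Z -> zhull A `<=` Z.
Proof.
move=> [S ->] AZ g [GLg Hg]; split=> // p Sp; apply: Hg => x /AZ[_]; exact.
Qed.

Lemma zhullS A X : A `<=` X -> zhull A `<=` zhull X.
Proof. by move=> AX g [GLg Hg]; split=> // p Hp; apply: Hg => x /AX /Hp. Qed.

Lemma zhull_zclosure A X : A `<=` X -> zhull A `<=` zclosure X.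
Proof.
move=> AX g Ag Z Zclosed XZ; apply: (zhull_subset Zclosed) Ag.
exact: subset_trans XZ.
Qed.

(** If neither closed set contains [A], each has an equation that fails somewhere on [A]; a point of
    [A] where both fail lies outside their union. *)
Lemma zirreducible_zhull A :
  A `<=` @GL F n -> A !=set0 ->
  (forall p1 p2 x1 x2, A x1 -> A x2 -> mxeval p1 x1 != 0 -> mxeval p2 x2 != 0 ->
     exists x, [/\ A x, mxeval p1 x != 0 & mxeval p2 x != 0]) ->
  zirreducible (zhull A).
Proof.
move=> AGL [a Aa] irrA; split; first by exists a; exact: subset_zhull.
move=> Z1 Z2 cZ1 cZ2 A12; apply: contrapT => /not_orP[nA1 nA2].
have escape Z : zclosed Z -> ~ (zhull A `<=` Z) ->
    exists p x, [/\ A x, mxeval p x != 0 & forall y, Z y -> mxeval p y = 0].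
  move=> cZ nAZ; have {}nAZ : ~ (A `<=` Z) by move/(zhull_subset cZ).
  case: cZ => S ZE; apply: contrapT => Hn; apply: nAZ => x Ax.
  rewrite ZE; split; first exact: AGL.
  move=> p Sp; apply: contrapT => /eqP px; apply: Hn; exists p, x; split=> //.
  by move=> y; rewrite ZE => -[_]; exact.
have [p1 [x1 [Ax1 px1 Zp1]]] := escape _ cZ1 nA1.
have [p2 [x2 [Ax2 px2 Zp2]]] := escape _ cZ2 nA2.
have [x [Ax p1x p2x]] := irrA _ _ _ _ Ax1 Ax2 px1 px2.
case: (A12 x (subset_zhull AGL Ax)) => [/Zp1|/Zp2] E.
  by rewrite E eqxx in p1x.
by rewrite E eqxx in p2x.
Qed.

End ZariskiHull.

(** * Dimension bound from a rational section *)

Section RationalSection.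
Local Open Scope classical_set_scope.
Variables (F : numFieldType) (n d : nat) (Y : set 'rV[F]_d).
Variable sigma : 'rV[F]_d -> 'M[F]_n.
Hypothesis Y0 : Y 0.
Hypothesis sigma_GL : forall v, Y v -> @GL F n (sigma v).
(** Openness of [Y] and rationality of [sigma] are tested on lines only, so that polynomials in one
    variable suffice. *)
Hypothesis sigma_regular : forall v u, exists q : {poly F},
  (forall t, Y (v + t *: u) <-> q.[t] != 0) /\
  regular_mx q (fun t => sigma (v + t *: u)).

Let flag (i : nat) : set 'rV[F]_d :=
  [set v | forall k : 'I_d, (i <= k)%N -> v 0 k = 0].

Let piece i : set 'M[F]_n := sigma @` (Y `&` flag i).

Let piece_GL i : piece i `<=` @GL F n.
Proof. by move=> _ [v [Yv _] <-]; exact: sigma_GL. Qed.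

(* Two points of a piece lie on the image of a line, where two nonvanishing
   conditions amount to one nonzero polynomial in a single variable. *)
Let piece_irreducible i : zirreducible (zhull (piece i)).
Proof.
apply: zirreducible_zhull; first exact: piece_GL.
  by exists (sigma 0), 0 => //; split=> // k _; rewrite mxE.
move=> p1 p2 _ _ [v [Yv fv] <-] [v' [Yv' fv'] <-] pv pv'.
have [q [Yq sr]] := sigma_regular v (v' - v).
have [m1 [P1 E1]] := regular_meval p1 sr.
have [m2 [P2 E2]] := regular_meval p2 sr.
have at0 : v + 0 *: (v' - v) = v by rewrite scale0r addr0.
have at1 : v + 1 *: (v' - v) = v' by rewrite scale1r addrC subrK.
have q0 : q.[0] != 0 by apply/Yq; rewrite at0.
have q1 : q.[1] != 0 by apply/Yq; rewrite at1.
have P10 : P1 != 0.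
  apply: contraNneq pv => P10; move: (E1 0 q0); rewrite P10 horner0 at0.
  by move/eqP; rewrite mulf_eq0 expf_eq0 (negPf q0) andbF.
have P20 : P2 != 0.
  apply: contraNneq pv' => P20; move: (E2 1 q1); rewrite P20 horner0 at1.
  by move/eqP; rewrite mulf_eq0 expf_eq0 (negPf q1) andbF.
have qn0 : q != 0 by apply: contraNneq q0 => ->; rewrite horner0.
have [t] : exists t, (q * (P1 * P2)).[t] != 0.
  by apply: exists_nonroot; rewrite !mulf_neq0.
rewrite !hornerM !mulf_eq0 !negb_or => /and3P[qt].
rewrite -E1 // -E2 // !mulf_eq0 !negb_or => /andP[_ p1t] /andP[_ p2t].
exists (sigma (v + t *: (v' - v))); split=> //.
exists (v + t *: (v' - v)) => //; split; first exact/Yq.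
by move=> k ik; rewrite !mxE fv // fv' // subrr mulr0 addr0.
Qed.

Hypothesis sigma_coord : forall k : 'I_d, exists p,
  forall v, Y v -> mxeval p (sigma v) = v 0 k.

(** The polynomial recovering coordinate [i] vanishes on [piece i], but not at the image of a
    nonzero point of [Y] on the corresponding axis; such a point exists because [Y] contains 0. *)
Let piece_proper i : (i < d)%N -> zhull (piece i) `<` zhull (piece i.+1).
Proof.
move=> id; split.
  apply: zhullS => _ [v [Yv fv] <-]; exists v => //; split=> // k /ltnW; exact: fv.
pose k := Ordinal id; have [p Hp] := sigma_coord k.
have [q [Yq _]] := sigma_regular 0 (delta_mx 0 k).
have q0 : q.[0] != 0 by apply/Yq; rewrite scale0r addr0.
have qn0 : q != 0 by apply: contraNneq q0 => ->; rewrite horner0.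
have [t] : exists t, (q * 'X).[t] != 0.
  by apply: exists_nonroot; rewrite mulf_neq0 // polyX_eq0.
rewrite hornerM hornerX mulf_eq0 negb_or => /andP[/Yq Yt t0].
set v := 0 + t *: delta_mx 0 k in Yt.
have pv : (zhull (piece i.+1)) (sigma v).
  apply: subset_zhull; first exact: piece_GL.
  exists v => //; split=> // j ij; rewrite !mxE eqxx add0r /=.
  by rewrite -val_eqE /= gtn_eqF // mulr0.
move/(_ _ pv) => -[_] /(_ p); rewrite Hp // => H.
have : v 0 k = 0.
  by apply: H => _ [u [Yu fu] <-]; rewrite Hp // fu.
by rewrite !mxE !eqxx add0r mulr1 => /eqP; rewrite (negPf t0).
Qed.

Lemma zdim_ge_rational_section (R : realType) (X : set 'M[F]_n) :
  (forall v, Y v -> X (sigma v)) -> ((d%:R)%:E <= zdim R X)%E.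
Proof.
move=> YX; apply: ereal.ereal_sup_ubound; exists d => //.
exists (fun i => zhull (piece i)); split=> [i _|i]; last exact: piece_proper.
split; [exact: zclosed_zhull | exact: piece_irreducible |].
by apply: zhull_zclosure => _ [v [Yv _] <-]; exact: YX.
Qed.

End RationalSection.

(** * Trajectories of row vectors through a word *)

Section Trajectories.
Variables (F : fieldType) (n r k : nat) (w : word F n r) (U : 'M[F]_(k, n)).
Implicit Types (h : 'I_r -> 'M[F]_n) (i : 'I_r) (s : bool) (j p : nat).

Definition prefix h j : 'M[F]_n :=
  coef w 0 *m \prod_(1 <= p < j.+1) (letter_eval w h p *m coef w p).

(* Row vectors traverse the word from left to right: [inp h p] enters the letter
   of index [p.+1] and [out h p] leaves it. *)
Definition inp h p : 'M[F]_(k, n) := U *m prefix h p.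

Definition out h p : 'M[F]_(k, n) := inp h p *m letter_eval w h p.+1.

(* The span of the vectors at which the first [j] letters constrain the variable
   [i]: arguments of [h i] for [s = false], values of [h i] for [s = true]. *)
Fixpoint side h i s j : 'M[F]_n :=
  if j is p.+1 then
    (side h i s p +
      (if var w p.+1 == i then if s == neg w p.+1 then inp h p else out h p
       else 0))%MS
  else 0.

Lemma inp0 h : inp h 0 = U *m coef w 0.
Proof. by rewrite /inp /prefix big_geq // mulmx1. Qed.

Lemma inpS h p : inp h p.+1 = out h p *m coef w p.+1.
Proof. by rewrite /out /inp /prefix big_nat_recr //= !mulmxA. Qed.

Lemma rank_adds_leq m (A : 'M[F]_n) (B : 'M[F]_(m, n)) :
  (\rank (A + B) <= \rank A + m)%N.
Proof.
apply: leq_trans (mxrank_adds_leqif A B) _.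
by rewrite leq_add2l rank_leq_row.
Qed.

Lemma rank_side h i s j : (\rank (side h i s j) <= j * k)%N.
Proof.
elim: j => [|j IHj]; first by rewrite mxrank0.
by rewrite mulSnr (leq_trans (rank_adds_leq _ _)) // leq_add2r.
Qed.

(** A variable carries its recorded arguments to its recorded values, and its inverse carries them
    back; the sign of the letter selects the direction. *)
Lemma side_mul_letter h j p :
  (forall i, h i \in unitmx) ->
  (side h (var w p) (neg w p) j *m letter_eval w h p
     :=: side h (var w p) (~~ neg w p) j)%MS.
Proof.
move=> hU; elim: j => [|j IHj] /=; first by rewrite mul0mx.
apply: eqmx_trans (addsmxMr _ _ _) (adds_eqmx IHj _).
case: eqP => [vj|_]; last by rewrite mul0mx.
rewrite /out /letter_eval vj.
case: (neg w p) (neg w j.+1) => -[] //=; rewrite ?mulmxK ?mulmxKV //.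
Qed.

Lemma inp_sub_side h j p : (p < j)%N ->
  (inp h p <= side h (var w p.+1) (neg w p.+1) j)%MS.
Proof.
elim: j => // j IHj; rewrite ltnS leq_eqVlt => /predU1P[->|/IHj] /=.
  by rewrite !eqxx addsmxSr.
by move=> H; exact: submx_trans (addsmxSl _ _).
Qed.

Lemma out_sub_side h j p : (p < j)%N ->
  (out h p <= side h (var w p.+1) (~~ neg w p.+1) j)%MS.
Proof.
elim: j => // j IHj; rewrite ltnS leq_eqVlt => /predU1P[->|/IHj] /=.
  by rewrite eqxx; case: (neg w j.+1); rewrite addsmxSr.
by move=> H; exact: submx_trans (addsmxSl _ _).
Qed.

(** Arranged so that letters in [i] of sign [s] are followed by [g] and those of the opposite sign
    are preceded by its inverse. *)
Definition twist h i s (g : 'M[F]_n) : 'I_r -> 'M[F]_n := fun i' =>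
  if i' == i then if s then invmx g *m h i else h i *m g else h i'.

Lemma invmxM (A B : 'M[F]_n) : A \in unitmx -> B \in unitmx ->
  invmx (A *m B) = invmx B *m invmx A.
Proof.
move=> AU BU; have ABU : A *m B \in unitmx by rewrite unitmx_mul AU.
apply: (can_inj (mulmxK ABU)); rewrite mulVmx //.
by rewrite mulmxA mulmxKV // mulVmx.
Qed.

Lemma letter_eval_twist h i s g p :
  (forall i', h i' \in unitmx) -> g \in unitmx ->
  letter_eval w (twist h i s g) p =
  if var w p == i then
    if neg w p == s then letter_eval w h p *m g
    else invmx g *m letter_eval w h p
  else letter_eval w h p.
Proof.
move=> hU gU; rewrite /letter_eval /twist; case: eqP => // ->.
case: (neg w p) s => -[] //=; rewrite invmxM ?unitmx_inv ?invmxK //.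
Qed.

Lemma mulmx_fixed m (A : 'M[F]_(m, n)) (S g : 'M[F]_n) :
  S *m g = S -> (A <= S)%MS -> A *m g = A.
Proof. by move=> Sg /submxP[D ->]; rewrite -mulmxA Sg. Qed.

Section Twist.
Variables (h : 'I_r -> 'M[F]_n) (i : 'I_r) (s : bool) (g : 'M[F]_n) (j : nat).
Hypothesis hU : forall i', h i' \in unitmx.
Hypothesis gU : g \in unitmx.
Hypothesis side_g : side h i (~~ s) j *m g = side h i (~~ s) j.

(** A letter of sign [s] has its outputs, and one of opposite sign its inputs, in the side fixed by
    [g]; so the trajectory is unchanged. *)
Let inp_letter_twist p : (p < j)%N ->
  inp h p *m letter_eval w (twist h i s g) p.+1 = out h p.
Proof.
move=> pj; rewrite letter_eval_twist // /out.
case: eqP => // vi; case: eqP => [ns|/eqP ns]; rewrite mulmxA.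
  by apply: mulmx_fixed side_g _; rewrite -vi -ns; exact: out_sub_side.
congr (_ *m _); rewrite -[RHS](mulmxK gU); congr (_ *m _); apply/esym.
apply: mulmx_fixed side_g _; rewrite -vi.
have -> : ~~ s = neg w p.+1 by case: (s) (neg w p.+1) ns => -[].
exact: inp_sub_side.
Qed.

Lemma inp_twist p : (p <= j)%N -> inp (twist h i s g) p = inp h p.
Proof.
elim: p => [|p IHp] pj; first by rewrite !inp0.
by rewrite !inpS {1}/out IHp 1?ltnW // inp_letter_twist.
Qed.

Lemma out_twist p : (p < j)%N -> out (twist h i s g) p = out h p.
Proof. by move=> pj; rewrite {1}/out inp_twist 1?ltnW // inp_letter_twist. Qed.

Lemma out_twist_last : var w j.+1 = i -> neg w j.+1 = s ->
  out (twist h i s g) j = out h j *m g.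
Proof.
by move=> vi ns; rewrite /out inp_twist // letter_eval_twist // vi ns !eqxx mulmxA.
Qed.

Lemma side_twist i' s' p : (p <= j)%N ->
  side (twist h i s g) i' s' p = side h i' s' p.
Proof.
elim: p => //= p IHp pj.
by rewrite IHp 1?ltnW // inp_twist 1?ltnW // out_twist.
Qed.

End Twist.

Lemma det_twist h i s g : (forall i', \det (h i') = 1) -> \det g = 1 ->
  forall i', \det (twist h i s g i') = 1.
Proof.
move=> h1 g1 i'; rewrite /twist; case: eqP => // _; case: s.
  by rewrite det_mulmx det_inv g1 invr1 h1 mulr1.
by rewrite det_mulmx g1 h1 mulr1.
Qed.

(* The letter of index [j.+1] can be given any values on the vectors entering it. *)
Definition ready h j : Prop :=
  (forall i, \det (h i) = 1) /\
  \rank (side h (var w j.+1) (neg w j.+1) j + inp h j) =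
    (\rank (side h (var w j.+1) (neg w j.+1) j) + k)%N.

Lemma det1_unitmx (g : 'M[F]_n) : \det g = 1 -> g \in unitmx.
Proof. by rewrite unitmxE => ->; exact: unitr1. Qed.

Lemma letter_eval_unit h p : (forall i, h i \in unitmx) ->
  letter_eval w h p \in unitmx.
Proof. by move=> hU; rewrite /letter_eval; case: ifP; rewrite ?unitmx_inv. Qed.

(** The letter is invertible and exchanges the two sides, so independence passes from incoming to
    outgoing vectors. *)
Lemma ready_out h j : ready h j ->
  \rank (side h (var w j.+1) (~~ neg w j.+1) j + out h j) =
    (\rank (side h (var w j.+1) (~~ neg w j.+1) j) + k)%N.
Proof.
move=> [h1 rk]; have hU i := det1_unitmx (h1 i).
have Lfree : row_free (letter_eval w h j.+1) by rewrite row_free_unit letter_eval_unit.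
have E := side_mul_letter j j.+1 hU.
rewrite -(adds_eqmx E (eqmx_refl _)) -addsmxMr -E !mxrankMfree //.
Qed.

Hypothesis kl : (k * wlen w < n)%N.
Hypothesis crit : forall j, Jminus w j -> forall mu : F, mu != 0 ->
  (k * wlen w <= \rank (coef w j - mu%:M)%R)%N.

Let coefU j : (j <= wlen w)%N -> coef w j \in unitmx.
Proof. exact: coef_GL. Qed.

Lemma rank_adds_mulr m (A : 'M[F]_n) (B : 'M[F]_(m, n)) (c : 'M[F]_n) :
  c \in unitmx -> \rank (A *m invmx c + B) = \rank (A + B *m c).
Proof.
move=> cU; have cfree : row_free c by rewrite row_free_unit.
by rewrite -(mxrankMfree (A *m invmx c + B)%MS cfree) addsmxMr mulmxKV.
Qed.

(** [S] holds the values already taken by the current variable, [V'] the constraints at the next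
    letter. Only at [Jminus] does [V'] involve [E], which calls for free pairs; otherwise the two
    conditions are met together after pulling [V'] back by the coefficient. *)
Lemma exists_next_row_space (S V : 'M[F]_n) (D : 'M[F]_(k, n)) j :
  (j.+1 < wlen w)%N -> (\rank S <= j * k)%N -> (\rank V <= j * k)%N ->
  (Jminus w j.+1 -> V = S) ->
  exists E : 'M[F]_(k, n), \rank (S + E) = (\rank S + k)%N /\
    let V' := (V + if Jminus w j.+1 then E else D)%MS in
    \rank (V' + E *m coef w j.+1) = (\rank V' + k)%N.
Proof.
move=> jl rS rV VS; have cU := coefU (ltnW jl).
have jk : (j.+2 * k < n)%N by apply: leq_ltn_trans kl; rewrite mulnC leq_mul.
have [J|_] /= := boolP (Jminus w j.+1).
  rewrite VS //; have [mu mu0|E rE] := exists_free_pairs_mod (W := S) (k := k) cU.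
    apply: leq_trans (crit J mu0); rewrite -muln2 mulnC.
    by move: rS jl; rewrite mulnC; nia.
  exists E; have := rank_adds_leq S E.
  by have := rank_adds_leq (S + E)%MS (E *m coef w j.+1); rewrite rE -addnn; lia.
have rVD := rank_adds_leq V D.
have [||E [rE rVE]] := exists_free_mod2 (k := k) (V := S)
    (W := (V + D)%MS *m invmx (coef w j.+1)).
- by move: jk rS; rewrite !mulSn; lia.
- rewrite mxrankMfree ?row_free_unit ?unitmx_inv //.
  by move: jk rV rVD; rewrite !mulSn; lia.
exists E; split=> //; rewrite -rank_adds_mulr // rVE.
by rewrite mxrankMfree // row_free_unit unitmx_inv.
Qed.

Lemma ready_step h j : (j.+1 < wlen w)%N -> ready h j -> exists h', ready h' j.+1.
Proof.
move=> jl rdy; have rT := ready_out rdy; have [h1 _] := rdy.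
pose i := var w j.+1; pose s := neg w j.+1.
pose i' := var w j.+2; pose s' := neg w j.+2.
pose V := side h i' s' j.
(* For a repeated variable and sign, the vectors entering the current letter constrain the next one;
   a different variable adds nothing. An opposite sign adds [E] instead. *)
pose D := if i == i' then inp h j else 0.
have [|||E [rE rVE]] := @exists_next_row_space (side h i (~~ s) j) V D j jl.
- exact: rank_side.
- exact: rank_side.
(* For a letter followed by its inverse, the arguments of the second are the values of the first. *)
- rewrite /Jminus /= => /andP[/andP[_ /eqP ii'] ss'].
  rewrite /V -/i' /i' -ii' -/i; congr side.
  by move: ss'; rewrite -/s -/s'; case: (s) (s') => -[].
have [|g [g1 Sg Tg]] := exists_SL_extending rT rE.
  apply: leq_ltn_trans kl; rewrite mulnC.
  apply: leq_trans (_ : j.+1 * k <= _)%N; last by rewrite leq_mul2r ltnW ?orbT.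
  by rewrite mulSnr leq_add2r rank_side.
have hU i0 := det1_unitmx (h1 i0); have gU := det1_unitmx g1.
exists (twist h i s g); split; first exact: det_twist.
have outE := out_twist_last hU gU Sg erefl erefl.
rewrite inpS /= outE (side_twist hU gU Sg) // (inp_twist hU gU Sg) // Tg.
rewrite -/i -/i' -/s -/s' -/V.
set V' := (V + _)%MS.
suff -> : V' = (V + if Jminus w j.+1 then E else D)%MS by [].
rewrite /V' /D /Jminus /= jl -/i -/i' -/s -/s'.
case: (i == i') => //=.
by rewrite eq_sym; case: (s == s').
Qed.

Lemma exists_ready j : (j < wlen w)%N -> row_free U -> exists h, ready h j.
Proof.
move=> jl Ufree; elim: j jl => [|j IHj] jl; last first.
  by have [h] := IHj (ltnW jl); exact: ready_step.
(* Nothing is constrained before the first letter, so the identity serves as a start. *)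
exists (fun=> 1%:M); split=> [i|]; first by rewrite det1.
rewrite /= inp0 adds0mx mxrank0 mxrankMfree ?row_free_unit ?coefU //.
exact/eqP.
Qed.

End Trajectories.

(** * Rational parametrization of the vectors leaving the last letter *)

Lemma exists_mxeval_bilinear (F : numFieldType) n (x : 'rV[F]_n) (y : 'cV[F]_n)
    (c : F) :
  exists p, forall g : 'M[F]_n, mxeval p g = (x *m g *m y) 0 0 + c.
Proof.
exists (\sum_j (\sum_i (x 0 i * y j 0) *:
    mpoly.mpolyX F (mpoly.mnm1 (mxvec_index i j))) + mpoly.mpolyC _ c) => g.
rewrite /mxeval mpoly.mevalD mpoly.mevalC; congr (_ + _).
rewrite !mxE raddf_sum; apply: eq_bigr => j _.
rewrite !mxE raddf_sum mulr_suml; apply: eq_bigr => i _.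
by rewrite /= mpoly.mevalZ mpoly.mevalXU mxvecE mulrAC.
Qed.

Lemma word_eval_prefix (F : fieldType) n r (w : word F n r) h :
  word_eval w h = prefix w h (wlen w).
Proof. by []. Qed.

Lemma word_eval_unit (F : fieldType) n r (w : word F n r) h :
  (forall i, h i \in unitmx) -> word_eval w h \in unitmx.
Proof.
move=> hU; rewrite word_eval_prefix.
have: (wlen w <= wlen w)%N by []; elim: {1 3}(wlen w) => [|j IHj] jl.
  by rewrite /prefix big_geq // mulmx1; exact: coef_GL.
rewrite /prefix big_nat_recr //= mulmxA -/(prefix w h j).
rewrite mulmxA 2!unitmx_mul IHj 1?ltnW // letter_eval_unit //=.
exact: coef_GL.
Qed.

Section Parametrization.
Variables (F : numFieldType) (n r k : nat) (w : word F n r) (U : 'M[F]_(k, n)).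
Variables (h : 'I_r -> 'M[F]_n) (j : nat).
Hypotheses (wl : wlen w = j.+1) (rdy : ready w U h j) (kl : (k * wlen w < n)%N).

Lemma regular_word_eval q (H : F -> 'I_r -> 'M[F]_n) :
  (forall t, q.[t] != 0 -> forall i, \det (H t i) = 1) ->
  (forall i, regular_mx q (fun t => H t i)) ->
  regular_mx q (fun t => word_eval w (H t)).
Proof.
move=> H1 Hr; rewrite -[X in regular_mx q X]/(fun t => prefix w (H t) (wlen w)).
elim: (wlen w) => [|p IHp].
  have -> : (fun t => prefix w (H t) 0) = fun=> coef w 0.
    by apply/funext => t; rewrite /prefix big_geq // mulmx1.
  exact: regular_mx_cst.
have -> : (fun t => prefix w (H t) p.+1) =
    fun t => prefix w (H t) p *m letter_eval w (H t) p.+1 *m coef w p.+1.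
  by apply/funext => t; rewrite /prefix big_nat_recr //= !mulmxA.
apply: regular_mxM; last exact: regular_mx_cst.
apply: regular_mxM; first exact: IHp.
rewrite /letter_eval; case: neg; last exact: Hr.
by apply: regular_mx_invmx => // t qt; exact: H1.
Qed.

(* The final vectors [T + N] of the trajectories of the rows of [U] can be
   prescribed freely near [T], and the variables that produce them are rational
   functions of [N]. *)
Lemma zdim_word_image_ready (R : realType) :
  (((k * n)%:R)%:E <= zdim R (word_image w (@SL F n)))%E.
Proof.
pose i := var w j.+1; pose s := neg w j.+1.
pose S := side w U h i (~~ s) j; pose T := out w U h j.
have rST : \rank (S + T) = (\rank S + k)%N := ready_out rdy.
have h1 := rdy.1; have hU i0 := det1_unitmx (h1 i0).
have [Q [SQ TQ]] := exists_dual rST.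
have [|a [b []]] := @exists_annihilator _ _ _ (col_mx S T).
  rewrite -addsmxE rST; apply: leq_ltn_trans kl.
  by rewrite wl mulnC mulSnr leq_add2r rank_side.
rewrite mul_col_mx -col_mx0 => /eq_col_mx[Sa Ta] ba.
(* [M v] fixes [S] and sends [T] to [T + vec_mx v]; where it is invertible, a stretch along [a] and
   [b], chosen independently of [v], restores determinant 1. *)
pose M (v : 'rV[F]_(k * n)) : 'M[F]_n := 1%:M + Q *m vec_mx v.
pose g v := stretch a b (\det (M v))^-1 *m M v.
have g1 v : \det (M v) != 0 -> \det (g v) = 1.
  by move=> Mv; rewrite det_mulmx det_stretch // mulVf.
have Sg v : S *m g v = S.
  by rewrite mulmxA mul_stretch // mulmxDr mulmx1 mulmxA SQ mul0mx addr0.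
have Tg v : T *m g v = T + vec_mx v.
  by rewrite mulmxA mul_stretch // mulmxDr mulmx1 mulmxA TQ mul1mx.
pose sigma v := word_eval w (twist h i s (g v)).
have sigma1 v : \det (M v) != 0 -> forall i0, \det (twist h i s (g v) i0) = 1.
  by move=> /g1; exact: det_twist.
have cU : coef w j.+1 \in unitmx by apply: coef_GL; rewrite wl.
have Usigma v : \det (M v) != 0 ->
    U *m sigma v *m invmx (coef w j.+1) = T + vec_mx v.
  move=> Mv; have gU := det1_unitmx (g1 v Mv).
  have := inpS w U (twist h i s (g v)) j.
  rewrite (out_twist_last hU gU (Sg v)) // Tg => E.
  by rewrite /sigma word_eval_prefix wl -/(inp w U _ j.+1) E mulmxK.
apply: (@zdim_ge_rational_section _ _ _ [set v | \det (M v) != 0] sigma).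
- by rewrite /= /M raddf0 mulmx0 addr0 det1 oner_neq0.
- by move=> v Mv; apply: word_eval_unit => i0; apply: det1_unitmx; exact: sigma1.
- move=> v u.
  have MR q : regular_mx q (fun t => M (v + t *: u)).
    apply: regular_mxD; first exact: regular_mx_cst.
    apply: regular_mxM; first exact: regular_mx_cst.
    under eq_fun do rewrite linearD linearZ.
    apply: regular_mxD; first exact: regular_mx_cst.
    by apply: regular_mxZ; [exact: regular_id | exact: regular_mx_cst].
  (* With denominator 1 the determinant is a genuine polynomial [q], which then serves as the
     denominator for everything else. *)
  have [m [q Hq]] := regular_det (MR 1).
  have {m}Hq t : \det (M (v + t *: u)) = q.[t].
    by rewrite -Hq ?hornerC ?oner_neq0 // expr1n mul1r.
  exists q; split=> [t|]; first by rewrite /= Hq.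
  have gr : regular_mx q (fun t => g (v + t *: u)).
    apply: regular_mxM; last exact: MR.
    apply: regular_mxD; first exact: regular_mx_cst.
    apply: regular_mxZ; last exact: regular_mx_cst.
    apply: regularD; last exact: regular_cst.
    by under eq_fun do rewrite Hq; exact: regularV.
  apply: regular_word_eval => [t qt|i0]; first by apply: sigma1; rewrite Hq.
  rewrite /twist; case: (i0 == i); last exact: regular_mx_cst.
  case: (s); apply: regular_mxM; try exact: regular_mx_cst.
    by apply: regular_mx_invmx => // t qt; apply: g1; rewrite Hq.
  exact: gr.
(* The entry at [x], [y] of [U *m g *m invmx (coef w j.+1) - T] is affine in [g], and at
   [g = sigma v] it is the matching coordinate of [v]. *)
- case/mxvec_indexP => x y.
  have [p Hp] :=
    exists_mxeval_bilinear (row x U) (col y (invmx (coef w j.+1))) (- T x y).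
  exists p => v Mv; rewrite Hp -row_mul colE mulmxA.
  rewrite -row_mul Usigma // -colE 3!mxE addrAC subrr add0r.
  by rewrite -mxvecE vec_mxK.
- move=> v Mv; exists (twist h i s (g v)) => //= i0; exact: sigma1.
Qed.

End Parametrization.

(** * Critical length and the final bound *)

Lemma leq_bigminn (I : eqType) (l : seq I) (P : pred I) (f : I -> nat) d m :
  (m <= \big[minn/d]_(i <- l | P i) f i)%N ->
  (m <= d)%N /\ forall i, i \in l -> P i -> (m <= f i)%N.
Proof.
elim: l => [|i l IHl]; first by rewrite big_nil.
rewrite big_cons; case: ifP => [Pi|nPi].
  rewrite leq_min => /andP[mi /IHl[md H]]; split=> // i0.
  by rewrite inE => /predU1P[->|/H].
move=> /IHl[md H]; split=> // i0; rewrite inE => /predU1P[->|/H //].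
by rewrite nPi.
Qed.

Lemma diam_GL_le (F : fieldType) n : (diam_GL F n <= n)%N.
Proof. by rewrite /diam_GL; case: ex_maxnP => m /dist_val_ub. Qed.

Lemma prank_le (F : fieldType) n (g : 'M[F]_n) (mu : F) :
  mu != 0 -> (prank g <= \rank (g - mu%:M)%R)%N.
Proof.
move=> mu0; rewrite /prank; case: ex_minnP => m _; apply.
by apply/asboolP; exists mu.
Qed.

(** A point is a section over the affine space of dimension 0; this settles the case of a
    nonpositive floor. *)
Lemma zdim_ge0 (F : numFieldType) n (R : realType) (X : set 'M[F]_n) g :
  X g -> g \in unitmx -> (0 <= zdim R X)%E.
Proof.
move=> Xg gU.
apply: (@zdim_ge_rational_section F n 0 setT (fun=> g)) => //; last by case.
move=> v u; exists 1; split=> [t|]; last exact: regular_mx_cst.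
by rewrite hornerC oner_neq0.
Qed.

(** The minimum in [crit_length] includes the diameter, which is at most [n], so the strict bound
    leaves room both in the whole space and at each letter of [Jminus]. *)
Lemma zdim_word_image_ge (F : numFieldType) n r (w : word F n r) k (R : realType) :
  (0 < wlen w)%N -> (k * wlen w < crit_length w)%N ->
  (((k * n)%:R)%:E <= zdim R (word_image w (@SL F n)))%E.
Proof.
move=> l0 /leq_bigminn[ld critJ].
have kl : (k * wlen w < n)%N := leq_trans ld (diam_GL_le _ _).
have crit j : Jminus w j -> forall mu : F, mu != 0 ->
    (k * wlen w <= \rank (coef w j - mu%:M)%R)%N.
  move=> Jj mu mu0; apply: leq_trans (prank_le _ mu0); apply/ltnW/critJ => //.
  by rewrite mem_index_iota; case/andP: Jj => /andP[].
have kn : (k <= n)%N by apply: leq_trans (ltnW kl); rewrite leq_pmulr.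
have Ufree : row_free (pid_mx k : 'M[F]_(k, n)) by rewrite /row_free rank_pid_mx.
have wl : wlen w = (wlen w).-1.+1 by rewrite prednK.
have jl : ((wlen w).-1 < wlen w)%N by rewrite -wl.
have [h rdy] := exists_ready kl crit jl Ufree.
exact: zdim_word_image_ready wl rdy kl R.
Qed.

Theorem theorem2 (R : realType) (n r : nat) (w : word R[i] n r) :
  reduced w (@SL R[i] n) ->
  (2 <= wlen w)%N ->
  (((Num.floor (((crit_length w)%:R - 1) / (wlen w)%:R : R) * n%:Z)%:~R)%:E
     <= zdim R (word_image w (@SL R[i] n)))%E.
Proof.
move=> _ l2; have l0 : (0 < wlen w)%N := ltnW l2.
have dim0 : (0 <= zdim R (word_image w (@SL R[i] n)))%E.
  apply: (@zdim_ge0 _ _ _ _ (word_eval w (fun=> 1%:M))).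
    by exists (fun=> 1%:M) => //= i; rewrite /SL /= det1.
  by apply: word_eval_unit => i; exact: unitmx1.
have := Num.Theory.floor_le (((crit_length w)%:R - 1) / (wlen w)%:R : R).
case: (Num.floor _) => [k|k]; last first.
  move=> _; apply: le_trans dim0.
  by rewrite lee_fin lerz0 NegzE mulNr oppr_le0.
case: k => [_|k]; first by rewrite mul0r.
(* The 1 subtracted from the critical length becomes the strictness of the integer inequality. *)
rewrite ler_pdivlMr ?ltr0n // lerBrDr => le_crit.
rewrite -PoszM; apply: zdim_word_image_ge => //.
by rewrite -(ler_nat R) -natr1 natrM.
Qed.
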